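(* Let $d\ge 2$ be an even integer, and let $u_1,\dots,u_{d+1}\in S^{d-1}$ be unit vectors in $\mathbb{R}^d$ satisfying $\sum_{i=1}^{d+1}u_i=0$. Then there exist signs $\varepsilon_1,\dots,\varepsilon_{d+1}\in\{\pm1\}$ such that $$|\varepsilon_1u_1+\dots+\varepsilon_{d+1}u_{d+1}|\ge\sqrt{d+2}.$$
   Context: $S^{d-1}$ denotes the unit sphere of $\mathbb{R}^d$ and $|\cdot|$ the Euclidean norm. *)

(* Defs.v *)
From mathcomp Require Import all_boot all_order all_algebra.
From mathcomp Require Import reals.
Set Implicit Arguments.
Unset Strict Implicit.
Unset Printing Implicit Defensive.
Import Order.TTheory GRing.Theory Num.Theory.
Local Open Scope ring_scope.

(* The norm [`|x|] that MathComp-Analysis puts on row vectors is the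
   sup norm, and [dotmx] of spectral.v lives over algebraically closed
   fields, hence a separate Euclidean norm. *)
Definition enorm (R : realType) (d : nat) (x : 'rV[R]_d) : R :=
  Num.sqrt (\sum_(k < d) x 0 k ^+ 2).

(* This is S^{d-1}, indexed by the ambient dimension d. *)
Definition unit_sphere (R : realType) (d : nat) : pred 'rV[R]_d :=
  [pred x | enorm x == 1].
Arguments unit_sphere R d : clear implicits.

(* Main.v *)
Require Import Defs.
From mathcomp Require Import all_boot all_order all_algebra.
From mathcomp Require Import reals.
From mathcomp Require Import ring lra zify.
Set Implicit Arguments.
Unset Strict Implicit.
Unset Printing Implicit Defensive.
Import Order.TTheory GRing.Theory Num.Theory.
Local Open Scope ring_scope.

(** Write [d + 1 = 2m + 1]. Giving the sign [+1] to the vectors of a subset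
    [A] and [-1] to the others produces, because the vectors sum to zero,
    twice the partial sum [s] of the vectors in [A]. It is therefore enough
    to find [A] with [|s|^2 >= (m + 1) / 2], and balanced subsets, those of
    size [m], suffice.

    Take [A] maximizing [|s|^2] among the subsets of size [m]. Exchanging
    [a] in [A] with [b] outside [A] cannot increase the norm, which means
    [|u_b - u_a|^2 + 2 <s, u_b - u_a> <= 0] ([exchange_le0]). Summing over
    all [m (m + 1)] pairs, and using that the vectors outside [A] sum to
    [-s], leaves only the cardinalities and multiples of [|s|^2]
    ([sum_exchanges]), and the total inequality reads
    [2 m (m + 1) - 4 m |s|^2 <= 0]. *)

Definition dot (R : realType) (d : nat) (x y : 'rV[R]_d) : R :=
  \sum_(k < d) x 0 k * y 0 k.

Section Dot.
Variables (R : realType) (d : nat).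
Implicit Types x y z : 'rV[R]_d.

Lemma dotC x y : dot x y = dot y x.
Proof. by apply: eq_bigr => k _; rewrite mulrC. Qed.

Lemma dotDr x y z : dot x (y + z) = dot x y + dot x z.
Proof. by rewrite -big_split; apply: eq_bigr => k _; rewrite mxE mulrDr. Qed.

Lemma dotZr x a y : dot x (a *: y) = a * dot x y.
Proof. by rewrite mulr_sumr; apply: eq_bigr => k _; rewrite mxE mulrCA. Qed.

Lemma dotNr x y : dot x (- y) = - dot x y.
Proof. by rewrite -scaleN1r dotZr mulN1r. Qed.

Lemma dotDl x y z : dot (x + y) z = dot x z + dot y z.
Proof. by rewrite !(dotC _ z) dotDr. Qed.

Lemma dotZl a x y : dot (a *: x) y = a * dot x y.
Proof. by rewrite !(dotC _ y) dotZr. Qed.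

Lemma dotNl x y : dot (- x) y = - dot x y.
Proof. by rewrite !(dotC _ y) dotNr. Qed.

Lemma dot_sumr (I : finType) (P : pred I) x (f : I -> 'rV[R]_d) :
  dot x (\sum_(i | P i) f i) = \sum_(i | P i) dot x (f i).
Proof.
rewrite exchange_big /=; apply: eq_bigr => k _.
by rewrite summxE mulr_sumr.
Qed.

Lemma dot_sqrD x y : dot (x + y) (x + y) = dot x x + 2 * dot x y + dot y y.
Proof. by rewrite !dotDr !dotDl (dotC y x); ring. Qed.

Lemma enormE x : enorm x = Num.sqrt (dot x x).
Proof. by congr Num.sqrt; apply: eq_bigr => k _; rewrite expr2. Qed.

Lemma unit_sphere_dot x : x \in unit_sphere R d -> dot x x = 1.
Proof.
rewrite inE enormE => /eqP x1; rewrite -[LHS]sqr_sqrtr ?x1 ?expr1n //.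
by apply: sumr_ge0 => k _; rewrite -expr2 sqr_ge0.
Qed.

End Dot.

Section BalancedSubset.
Variables (R : realType) (d : nat) (T : finType) (u : T -> 'rV[R]_d).
Implicit Type A : {set T}.

Let psum A : 'rV[R]_d := \sum_(i in A) u i.

(** The exchange replaces [s] by [s + (u b - u a)], and expanding the square
    of the new norm leaves exactly this increment. *)
Lemma exchange_le0 A a b :
    (forall B : {set T}, #|B| = #|A| ->
       dot (psum B) (psum B) <= dot (psum A) (psum A)) ->
    a \in A -> b \notin A ->
  dot (u b - u a) (u b - u a) + 2 * dot (psum A) (u b - u a) <= 0.
Proof.
move=> Amax aA bA; pose B := b |: A :\ a.
have bAa : b \notin A :\ a by rewrite !inE (negPf bA) andbF.
have cardB : #|B| = #|A| by rewrite cardsU1 bAa (cardsD1 a A) aA.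
have sumB : psum B = psum A + (u b - u a).
  rewrite /psum big_setU1 //= (big_setD1 a aA) /=.
  by rewrite [RHS]addrC -addrA addKr.
by have := Amax B cardB; rewrite sumB (dot_sqrD (psum A)); lra.
Qed.

Hypothesis u_unit : forall i, dot (u i) (u i) = 1.
Hypothesis u_sum0 : \sum_i u i = 0.

Lemma psumC A : psum (~: A) = - psum A.
Proof.
apply/eqP; rewrite -addr_eq0 -u_sum0 (bigID [in A]) /= addrC; apply/eqP.
by congr (_ + _); apply: eq_bigl => i; rewrite inE.
Qed.

(** The summand is affine in [u b] for fixed [a], then affine in [u a]
    after the summation over [b], because the vectors are unit. The sums of
    [u b] and of [u a] are [- s] and [s], so only [dot s s] survives. *)
Lemma sum_exchanges A :
  \sum_(a in A) \sum_(b in ~: A)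
     (dot (u b - u a) (u b - u a) + 2 * dot (psum A) (u b - u a)) =
  2 * #|A|%:R * #|~: A|%:R - 2 * (#|T|%:R - 1) * dot (psum A) (psum A).
Proof.
set s := psum A; set q := dot s s.
have expand a b : dot (u b - u a) (u b - u a) + 2 * dot s (u b - u a) =
    (2 - 2 * dot s (u a)) + dot (2 *: (s - u a)) (u b).
  rewrite !(dotDr, dotDl, dotNr, dotNl, dotZl) (dotC (u b) (u a)) !u_unit.
  by ring.
have inner a : \sum_(b in ~: A)
      (dot (u b - u a) (u b - u a) + 2 * dot s (u b - u a)) =
    (2 * #|~: A|%:R - 2 * q) + dot ((2 - 2 * #|~: A|%:R) *: s) (u a).
  under eq_bigr => b _ do rewrite expand.
  rewrite big_split /= sumr_const -dot_sumr -/(psum _) psumC -/s.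
  rewrite !(dotDl, dotNr, dotNl, dotZl) (dotC (u a)) -mulr_natr /q.
  by ring.
under eq_bigr => a _ do rewrite inner.
rewrite big_split /= sumr_const -dot_sumr -/(psum _) -/s dotZl -/q.
by rewrite -mulr_natr -(cardsC A) natrD; ring.
Qed.

(** With [#|A| = m] and [#|~: A| = m.+1] the total of the exchanges is
    [2 m (m + 1) - 4 m |s|^2]; at a maximizer it is nonpositive, and
    cancelling [2 m > 0] gives the bound. *)
Lemma balanced_subset m : (0 < m)%N -> #|T| = m.*2.+1 ->
  exists A, m.+1%:R <= 2 * dot (psum A) (psum A).
Proof.
move=> m_gt0 cardT.
have /card_gt0P[A0] : (0 < #|[set A : {set T} | #|A| == m]|)%N.
  by rewrite card_draws cardT bin_gt0; lia.
rewrite inE => A0m.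
case: (@arg_maxP _ _ _ A0 (fun A : {set T} => #|A| == m)
         (fun A => dot (psum A) (psum A)) A0m) => A /eqP cardA Amax.
exists A.
have cardCA : #|~: A| = m.+1 by have := cardsC A; rewrite cardA cardT; lia.
have : \sum_(a in A) \sum_(b in ~: A)
     (dot (u b - u a) (u b - u a) + 2 * dot (psum A) (u b - u a)) <= 0.
  apply: sumr_le0 => a aA; apply: sumr_le0 => b; rewrite inE => bA.
  by apply: exchange_le0 => // B cardB; apply: Amax; rewrite cardB cardA.
rewrite sum_exchanges cardA cardCA cardT -addn1 -(addn1 m.*2) -addnn !natrD.
rewrite addrK => le0.
have m0 : 0 < m%:R :> R by rewrite ltr0n.
rewrite -(ler_pM2l m0); lra.
Qed.

End BalancedSubset.

Theorem theorem6 (R : realType) (d : nat) (u : 'I_d.+1 -> 'rV[R]_d)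
    (d_ge2 : (2 <= d)%N) (d_even : ~~ odd d)
    (u_unit : forall i, u i \in unit_sphere R d)
    (u_sum0 : \sum_(i < d.+1) u i = 0) :
  exists eps : 'I_d.+1 -> R,
    (forall i, eps i = 1 \/ eps i = -1) /\
    Num.sqrt (d + 2)%:R <= enorm (\sum_(i < d.+1) eps i *: u i).
Proof.
have d2 : d = d./2.*2 by rewrite even_halfK.
have [||A leA] := @balanced_subset _ _ _ u
  (fun i => unit_sphere_dot (u_unit i)) u_sum0 d./2.
- by lia.
- by rewrite card_ord -d2.
exists (fun i => if i \in A then 1 else -1); split.
  by move=> i; case: ifP; [left | right].
set s := \sum_(i in A) u i in leA.
have -> : \sum_(i < d.+1) (if i \in A then 1 else -1) *: u i = 2 *: s.
  rewrite (bigID [in A]) /= scaler_nat mulr2n; congr (_ + _).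
    by apply: eq_bigr => i ->; rewrite scale1r.
  rewrite -[RHS]opprK -(psumC u_sum0) -sumrN.
  apply: eq_big => [i|i /negPf->]; first by rewrite inE.
  by rewrite scaleN1r.
rewrite enormE; apply: ler_wsqrtr; rewrite dotZr dotZl.
have -> : (d + 2)%:R = 2 * (d./2.+1)%:R :> R.
  by rewrite -natrM; congr _%:R; lia.
lra.
Qed.
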